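(* Let $L,N,L',N'\in\mathbb{R}_{\ge0}$, $m\in\mathbb{N}$, and consider a causal differentiator $\mathcal{D}$ of order $m$. Suppose that $\mathcal{D}$ has best worst-case error over $\mathcal{F}_L^m$ with respect to noise in $\mathcal{E}_N$. Then a) $\mathcal{D}$ has best worst-case error over $\mathcal{F}_{\alpha L}^m$ with respect to noise in $\mathcal{E}_{\alpha N}$ for all $\alpha\in[0,1]$; b) $\mathcal{D}$ is exact from the beginning over $\mathcal{F}_0^m$; c) $\mathcal{D}$ is robust almost from the beginning over $\mathcal{F}_0^m$, if $N>0$; d) $\mathcal{D}$ is not exact over $\mathcal{F}_L^m$, if $N>0$ and $L>0$; e) $\mathcal{D}$ can have best worst-case error over $\mathcal{F}_{L'}^m$ with respect to noise in $\mathcal{E}_{N'}$ only if $LN'=L'N$.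
   Context: For $m\in\mathbb{N}_0$ and $L,N\ge 0$: $\mathcal{F}^m$ is the set of functions $f:\mathbb{R}_{\ge 0}\to\mathbb{R}$ that are $m$ times continuously differentiable with $f^{(m)}$ Lipschitz continuous; $\mathcal{F}_L^m=\{f\in\mathcal{F}^m: |f^{(m+1)}(t)|\le L\text{ a.e. on }\mathbb{R}_{\ge0}\}$; $\mathcal{E}_N=\{\eta:\mathbb{R}_{\ge0}\to\mathbb{R}: |\eta(t)|\le N\text{ for all }t\ge0\}$; $\mathcal{F}_L^m+\mathcal{E}_N=\{f+\eta: f\in\mathcal{F}_L^m,\eta\in\mathcal{E}_N\}$; and $\mathcal{U}=\bigcup_{m\in\mathbb{N}_0,\,L,N\ge0}(\mathcal{F}_L^m+\mathcal{E}_N)$. For $\mathbf{R}=(R_0,\dots,R_m)\in\mathbb{R}_{\ge0}^{m+1}$, $\mathcal{F}_{L,\mathbf{R}}^m=\{f\in\mathcal{F}_L^m:|f^{(i)}(0)|\le R_i,\ i=0,\dots,m\}$. Here $f^{(0)}=f$ and derivatives at $0$ are one-sided. A differentiator of order $m$ is an operator $\mathcal{D}:\mathcal{U}\to(\mathbb{R}_{\ge0}\to\mathbb{R}^m)$, with components $\mathcal{D}_1,\dots,\mathcal{D}_m$. It is causal if for all $t\ge0$, $[\mathcal{D}u_1](t)=[\mathcal{D}u_2](t)$ whenever $u_1=u_2$ on $[0,t]$. Worst-case error over $\mathcal{S}\subseteq\mathcal{F}^m$: $M_{N,i}^{\mathcal{S}}(t)=\sup_{f\in\mathcal{S},\,\eta\in\mathcal{E}_N}\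 \sup_{\tau\ge t}|f^{(i)}(\tau)-[\mathcal{D}_i(f+\eta)](\tau)|\in[0,\infty]$. For $T>0$, $\mathcal{G}^m_{L,N}(T)=\{g\in\mathcal{F}_L^m:|g(t)|\le N\text{ for all }t\in[0,T]\}$ and $\bar g^{m,L}_{N,k}(T)=\sup\{g^{(k)}(T):g\in\mathcal{G}^m_{L,N}(T)\}$. A causal differentiator $\mathcal{D}$ of order $m$ has best worst-case error over $\mathcal{F}_L^m$ with respect to noise in $\mathcal{E}_N$ if $M_{N,k}^{\mathcal{F}_{L,\mathbf{R}}^m}(t)\le\bar g_{N,k}^{m,L}(t)$ for all $\mathbf{R}\in\mathbb{R}_{\ge0}^{m+1}$, $t>0$ and $k\in\{1,\dots,m\}$. Exactness: $\mathcal{D}$ is exact from the beginning over $\mathcal{F}_L^m$ if $M_{0,i}^{\mathcal{F}_L^m}(t)=0$ for all $t>0$ and $i=1,\dots,m$; exact in finite time over $\mathcal{F}_L^m$ if for every $\mathbf{R}\in\mathbb{R}_{\ge0}^{m+1}$ there exists $t_{\mathbf{R}}>0$ such that $M_{0,i}^{\mathcal{F}_{L,\mathbf{R}}^m}(t_{\mathbf{R}})=0$ for $i=1,\dots,m$; and not exact over $\mathcal{F}_L^m$ if it is not exact in finite time over $\mathcal{F}_L^m$. Robustness: for $\mathcal{S}\subseteq\mathcal{U}$ and $\epsilon>0$ let $Q^{\mathcal{S}}_{\epsilon,i}(t)=\sup_{u_1\in\mathcal{S},\,\eta\in\mathcal{E}_\epsilon}\ \sup_{\tau\ge t}|[\mathcal{D}_iu_1](\tau)-[\mathcal{D}_i(u_1+\eta)](\tau)|$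 and $Q^{\mathcal{S}}_i(t)=\lim_{\epsilon\to0^+}Q^{\mathcal{S}}_{\epsilon,i}(t)$. $\mathcal{D}$ is robust almost from the beginning over $\mathcal{S}$ if $Q_i^{\mathcal{S}}(t)=0$ for all $t>0$ and $i=1,\dots,m$. *)

(* Defs.v *)
From mathcomp Require Import all_boot all_order all_algebra.
From mathcomp Require Import all_classical all_reals all_analysis.

Set Implicit Arguments.
Unset Strict Implicit.
Unset Printing Implicit Defensive.

Import Order.TTheory GRing.Theory Num.Theory.
Import numFieldNormedType.Exports.

Local Open Scope classical_set_scope.
Local Open Scope ring_scope.

(* Functions on the half-line [0, +oo[ are represented by total functions
   R -> R.  Every definition below inspects its arguments at nonnegative
   times only; in particular, the values of a causal differentiator at
   nonnegative times do not depend on its input at negative times. *)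

Section FunctionClasses.
Variable R : realType.
Implicit Types (f g eta u : R -> R) (m k : nat) (L N t T : R).

(* The difference quotient of f at t, along s -> t with s >= 0 and s != t:
   two-sided for t > 0, right-sided at t = 0. *)
Definition hl_quotients f t : set_system R :=
  (f s - f t) / (s - t) @[s --> within `[0, +oo[ t^'].

Definition hl_derivable f t : Prop := cvg (hl_quotients f t).

Definition hl_derive f : R -> R := fun t => lim (hl_quotients f t).

Definition hl_deriven k f : R -> R := iter k hl_derive f.

Definition smooth_class m : set (R -> R) :=
  [set f | [/\ forall k t, (k < m)%N -> 0 <= t ->
                 hl_derivable (hl_deriven k f) t,
               {within `[0, +oo[, continuous (hl_deriven m f)} &
               [lipschitz (hl_deriven m f) t | t in `[0, +oo[ ] ] ].

Definition smooth_class_le m L : set (R -> R) :=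
  [set f | smooth_class m f /\
    {ae lebesgue_measure, forall t : R, 0 <= t ->
       hl_derivable (hl_deriven m f) t /\ `|hl_deriven m.+1 f t| <= L} ].

Definition noise_class N : set (R -> R) :=
  [set eta | forall t, 0 <= t -> `|eta t| <= N].

Definition noisy_signals m L N : set (R -> R) :=
  [set f \+ eta | f in smooth_class_le m L & eta in noise_class N].

Definition admissible_input : set (R -> R) :=
  [set u | exists m L N, [/\ 0 <= L, 0 <= N & noisy_signals m L N u] ].

Definition smooth_class_init m L (r : 'I_m.+1 -> R) : set (R -> R) :=
  [set f | smooth_class_le m L f /\
           forall i : 'I_m.+1, `|hl_deriven i f 0| <= r i].

Definition bounded_upto m L N T : set (R -> R) :=
  [set g | smooth_class_le m L g /\ forall t, 0 <= t <= T -> `|g t| <= N].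

Definition gbar m L N k T : \bar R :=
  ereal_sup [set (hl_deriven k g T)%:E | g in bounded_upto m L N T].

End FunctionClasses.

Section Differentiators.
Variables (R : realType) (m : nat).

(* Only the outputs at nonnegative times for inputs in admissible_input are
   ever used.  For i : 'I_m, the entry  D u t ord0 i  estimates the derivative
   of order i.+1. *)
Definition differentiator := (R -> R) -> R -> 'rV[R]_m.

Implicit Types (D : differentiator) (S : set (R -> R)) (i : 'I_m).
Implicit Types (L N t eps : R).

Definition causal D : Prop :=
  forall u1 u2 : R -> R, admissible_input u1 -> admissible_input u2 ->
  forall t, 0 <= t -> (forall s, 0 <= s <= t -> u1 s = u2 s) ->
  D u1 t = D u2 t.

Definition worst_case_error D N S i t : \bar R :=
  ereal_sup [set
    ereal_sup [set `|hl_deriven i.+1 f tau - D (f \+ eta) tau ord0 i|%:E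
              | tau in `[t, +oo[ ]
    | f in S & eta in noise_class N].

Definition best_worst_case D L N : Prop :=
  forall r : 'I_m.+1 -> R, (forall j, 0 <= r j) ->
  forall t, 0 < t -> forall i,
  (worst_case_error D N (smooth_class_init L r) i t <= gbar m L N i.+1 t)%E.

Definition exact_from_beginning D L : Prop :=
  forall t, 0 < t -> forall i,
  worst_case_error D 0 (smooth_class_le m L) i t = 0%E.

Definition exact_in_finite_time D L : Prop :=
  forall r : 'I_m.+1 -> R, (forall j, 0 <= r j) ->
  exists2 t, 0 < t &
    forall i, worst_case_error D 0 (smooth_class_init L r) i t = 0%E.

Definition not_exact D L : Prop := ~ exact_in_finite_time D L.

Definition output_deviation D S eps i t : \bar R :=
  ereal_sup [set
    ereal_sup [set `|D u tau ord0 i - D (u \+ eta) tau ord0 i|%:E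
              | tau in `[t, +oo[ ]
    | u in S & eta in noise_class eps].

(* output_deviation is nondecreasing in eps, so its limit at 0+ always exists
   in \bar R; the condition is that this limit is 0. *)
Definition robust_almost_from_beginning D S : Prop :=
  forall t, 0 < t -> forall i,
  output_deviation D S eps i t @[eps --> 0^'+] --> 0%E.

End Differentiators.

(* Main.v *)
Require Import Defs.
From mathcomp Require Import all_boot all_order all_algebra.
From mathcomp Require Import all_classical all_reals all_analysis.
From mathcomp Require Import measurable_realfun ring lra.

Set Implicit Arguments.
Unset Strict Implicit.
Unset Printing Implicit Defensive.

Import Order.TTheory GRing.Theory Num.Theory.
Import numFieldNormedType.Exports.
Local Open Scope classical_set_scope.
Local Open Scope ring_scope.

(* By causality, the estimate at time T of any input that stays within N of f
   on [0, T] is within gbar_T(L, N) of the derivative of f at T.  Perturbing f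
   by a nearly extremal g improves this bound by the factor alpha on the scaled
   classes, which gives a), and b), c) follow with alpha = 0 and
   alpha = eps / N.  If two such bounds hold, for (L1, N1) and (L2, N2), then
   sharing one input between two signals shows
   gbar_T(L1 + L2, N1 + N2) <= gbar_T(L1, N1) + gbar_T(L2, N2).
   For the first derivative, Phi = inf_T gbar_T satisfies
   Phi(L, N) = L^(1/(m+1)) Phi(1, N) with Phi(1, N) > 0, by rescaling time.
   Hence Phi is strictly increasing and strictly concave in L, which
   contradicts that inequality unless (L1, N1) and (L2, N2) are proportional,
   and contradicts gbar_T(2 L, N) <= gbar_T(L, N), which exactness over F_L
   would force for large T. *)

(** * One-sided calculus on the half-line *)

Section HalfLineCalculus.
Variable R : realType.
Implicit Types (f g : R -> R) (s t d e L : R).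

(** Division-free form of the limit of [hl_quotients]: it allows [s = t], and the endpoint 0 needs
    no separate treatment. *)
Definition hl_has_derivative f t d := forall e, 0 < e ->
  exists2 del, 0 < del & forall s, 0 <= s -> `|s - t| < del ->
    `|f s - f t - d * (s - t)| <= e * `|s - t|.

(** Properness makes limits along this filter unique, so that [hl_derive] is determined by any
    derivative exhibited. *)
Lemma hl_dnbhs_proper t : 0 <= t -> ProperFilter (within `[0, +oo[ t^').
Proof.
move=> t0; apply: Build_ProperFilter_ex => P.
rewrite /within /= => -[e /= e0 eP].
exists (t + e / 2); apply: eP => /=.
- by rewrite opprD addNKr normrN gtr0_norm; lra.
- by apply/eqP; lra.
- by rewrite in_itv /= andbT; lra.
Qed.

Lemma hl_has_derivativeP f t d :
  hl_quotients f t --> d <-> hl_has_derivative f t d.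
Proof.
split.
- move=> /cvgrPdist_le fd e e0.
  have := fd e e0; rewrite near_withinE /= => -[del /= del0 H].
  exists del => // s s0 st; have [->|snt] := eqVneq s t.
    by rewrite !subrr mulr0 subr0 normr0 mulr0.
  have /= := H s; rewrite distrC in_itv /= andbT => /(_ st snt s0).
  have s_t : s - t != 0 by rewrite subr_eq0.
  have quotB : (f s - f t - d * (s - t)) / (s - t) = (f s - f t) / (s - t) - d.
    by rewrite mulrBl mulfK.
  rewrite distrC -ler_pdivrMr ?normr_gt0 // -normf_div.
  by rewrite quotB.
- move=> fd; apply/cvgrPdist_le => e e0.
  have [del del0 H] := fd e e0.
  rewrite near_withinE /=; exists del => //= s st snt.
  rewrite in_itv /= andbT => s0; rewrite /ball_ /= distrC in st.
  have s_t : s - t != 0 by rewrite subr_eq0.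
  have quotB : (f s - f t - d * (s - t)) / (s - t) = (f s - f t) / (s - t) - d.
    by rewrite mulrBl mulfK.
  have := H s s0 st; rewrite -ler_pdivrMr ?normr_gt0 // -normf_div.
  by rewrite quotB // distrC.
Qed.

Lemma hl_deriveE f t d : 0 <= t -> hl_has_derivative f t d -> hl_derive f t = d.
Proof.
move=> t0 /hl_has_derivativeP fd; have := hl_dnbhs_proper t0 => PF.
exact: cvg_lim fd.
Qed.

Lemma hl_derivableP f t : 0 <= t ->
  hl_derivable f t <-> hl_has_derivative f t (hl_derive f t).
Proof.
move=> t0; rewrite -hl_has_derivativeP; split => [/cvg_ex[d fd]|fd].
  by have := hl_dnbhs_proper t0 => PF; rewrite /hl_derive (cvg_lim _ fd).
by apply/cvg_ex; exists (hl_derive f t).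
Qed.

Lemma eq_hl_has_derivative f g t d : 0 <= t ->
  (forall s, 0 <= s -> f s = g s) ->
  hl_has_derivative f t d -> hl_has_derivative g t d.
Proof.
move=> t0 fg fd e /fd[del del0 H]; exists del => // s s0.
by rewrite -!fg //; exact: H.
Qed.

Lemma hl_has_derivative_lin a b f g t d1 d2 :
  hl_has_derivative f t d1 -> hl_has_derivative g t d2 ->
  hl_has_derivative (fun s => a * f s + b * g s) t (a * d1 + b * d2).
Proof.
(* The summand 1 keeps [c] positive when [a = b = 0]. *)
move=> fd gd e e0; set c := `|a| + `|b| + 1.
have c0 : 0 < c by rewrite /c; have := normr_ge0 a; have := normr_ge0 b; lra.
have ec0 : 0 < e / c by rewrite divr_gt0.
have [d d0 H] := fd _ ec0; have [d' d'0 H'] := gd _ ec0.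
exists (Num.min d d'); first by rewrite lt_min d0.
move=> s s0; rewrite lt_min => /andP[/(H s s0) h1 /(H' s s0) h2].
rewrite [X in `|X|](_ : _ = a * (f s - f t - d1 * (s - t)) +
                            b * (g s - g t - d2 * (s - t))); last by ring.
rewrite (le_trans (ler_normD _ _)) // !normrM.
apply: (@le_trans _ _ ((`|a| + `|b|) * (e / c * `|s - t|))).
  by rewrite mulrDl lerD // ler_wpM2l.
rewrite mulrA ler_wpM2r // mulrCA ler_piMr ?(ltW e0) // ler_pdivrMr // mul1r.
by rewrite /c; lra.
Qed.

Lemma hl_has_derivative_affine lam c f t d : 0 < lam -> 0 <= c ->
  hl_has_derivative f (lam * t + c) d ->
  hl_has_derivative (fun s => f (lam * s + c)) t (lam * d).
Proof.
move=> lam0 c0 fd e e0.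
have el0 : 0 < e / lam by rewrite divr_gt0.
have [del del0 H] := fd _ el0.
exists (del / lam); first by rewrite divr_gt0.
move=> s s0 st.
have E : lam * s + c - (lam * t + c) = lam * (s - t) by ring.
have := H (lam * s + c); rewrite E => H1.
have := H1 _ _; rewrite normrM gtr0_norm // [e / lam * _]mulrA divfK ?gt_eqF //.
rewrite mulrA [d * lam]mulrC; apply.
  by rewrite addr_ge0 // mulr_ge0 // ltW.
by rewrite mulrC -ltr_pdivlMr.
Qed.

Lemma hl_has_derivative_is_derive f t d : 0 < t ->
  hl_has_derivative f t d -> is_derive t 1 f d.
Proof.
move=> t0 fd.
have H : h^-1 *: ((f \o shift t) (h *: 1) - f t) @[h --> 0^'] --> d.
  apply/cvgrPdist_le => e e0; have [del del0 {}fd] := fd e e0.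
  (* The bound by [t] keeps [h + t] on the half-line. *)
  exists (Num.min del t) => /=; first by rewrite lt_min del0.
  move=> h; rewrite /ball_ /= sub0r normrN lt_min => /andP[hd ht] hn0.
  have := fd (h + t); rewrite addrK => /(_ _ hd) H.
  rewrite /shift /= [h *: 1]mulr1 distrC.
  have -> : h^-1 *: (f (h + t) - f t) - d = (f (h + t) - f t - d * h) / h.
    by rewrite [LHS]/(_ * _ - _) mulrBl mulfK // mulrC.
  rewrite normf_div ler_pdivrMr ?normr_gt0 //; apply: H.
  by have := ler_norm (- h); rewrite normrN; lra.
apply: DeriveDef; first by apply/cvg_ex; exists d.
exact: cvg_lim H.
Qed.

Lemma is_derive_hl_has_derivative f t d :
  is_derive t 1 f d -> hl_has_derivative f t d.
Proof.
move=> [fd fE] e e0.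
have : h^-1 *: ((f \o shift t) (h *: 1) - f t) @[h --> 0^'] --> d.
  by rewrite -fE; exact: fd.
move=> /cvgrPdist_le/(_ e e0)[del /= del0 H].
exists del => // s s0 st; have [->|snt] := eqVneq s t.
  by rewrite !subrr mulr0 subr0 normr0 mulr0.
have s_t : s - t != 0 by rewrite subr_eq0.
have := H (s - t); rewrite /ball_ /= sub0r normrN => /(_ st s_t).
rewrite /shift /= [(s - t) *: 1]mulr1 subrK distrC.
have -> : (s - t)^-1 *: (f s - f t) - d = (f s - f t - d * (s - t)) / (s - t).
  by rewrite [LHS]/(_ * _ - _) mulrBl mulfK // mulrC.
by rewrite normf_div ler_pdivrMr ?normr_gt0.
Qed.

Lemma hl_has_derivative_cvg f t d : hl_has_derivative f t d ->
  forall A : set R, A `<=` `[0, +oo[ -> f @ within A (nbhs t) --> f t.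
Proof.
move=> fd A A0; apply/cvgrPdist_le => e e0.
have [del del0 H] := fd 1 ltr01.
pose c := `|d| + 1; have c0 : 0 < c by rewrite ltr_wpDl.
rewrite near_withinE; exists (Num.min del (e / c)).
  by rewrite /= lt_min del0 divr_gt0.
move=> s; rewrite /ball_ /= lt_min distrC => /andP[st se] /A0.
rewrite /= in_itv /= andbT => s0.
rewrite distrC -[f s - f t](subrK (d * (s - t))).
rewrite (le_trans (ler_normD _ _)) // normrM.
rewrite (@le_trans _ _ (c * `|s - t|)) //.
  by rewrite /c mulrDl addrC lerD2l; exact: H.
by rewrite mulrC -ler_pdivlMr // ltW.
Qed.

(** The classical theorem needs two-sided derivatives only on the open interval, where [t > 0]; at
    the endpoints, possibly 0, continuity within the interval suffices. *)
Lemma hl_MVT f df a b : 0 <= a -> a < b ->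
  (forall t, a <= t <= b -> hl_has_derivative f t (df t)) ->
  exists2 c, a <= c <= b & f b - f a = df c * (b - a).
Proof.
move=> a0 ab fd.
have [| |c] := @MVT R f df a b ab.
- move=> x; rewrite in_itv /= => /andP[ax xb].
  apply: hl_has_derivative_is_derive; first exact: le_lt_trans ax.
  by apply: fd; rewrite !ltW.
- apply/subspace_continuousP => x; rewrite /= in_itv /= => xab.
  apply: (hl_has_derivative_cvg (fd _ xab)) => y /=.
  by rewrite !in_itv /= andbT => /andP[ay _]; exact: le_trans ay.
- by rewrite in_itv /= => /andP[ac cb] ->; exists c => //; rewrite !ltW.
Qed.

Lemma hl_MVT_le f df a b B : 0 <= a -> a <= b ->
  (forall t, a <= t <= b -> hl_has_derivative f t (df t)) ->
  (forall t, a <= t <= b -> `|df t| <= B) -> `|f b - f a| <= B * (b - a).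
Proof.
move=> a0; rewrite le_eqVlt => /orP[/eqP <- _ _|ab fd dfB].
  by rewrite !subrr normr0 mulr0.
have [c cab ->] := hl_MVT a0 ab fd.
by rewrite normrM [`|b - a|]gtr0_norm ?subr_gt0 // ler_wpM2r ?dfB // subr_ge0 ltW.
Qed.

End HalfLineCalculus.

(** * Lipschitz functions and almost everywhere derivatives *)

Section AlmostEverywhere.
Variable R : realType.
Implicit Types (f g h : R -> R) (s t d e K L : R).

Let mu := @lebesgue_measure R.

(** The pushforward of Lebesgue measure under [lam * x + c], multiplied by [lam], agrees with
    Lebesgue measure on half-open intervals, hence everywhere; preimages of null sets are therefore
    null. *)
Lemma lebesgue_negligible_affine lam c (A : set R) : 0 < lam ->
  mu.-negligible A -> mu.-negligible [set x | A (lam * x + c)].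
Proof.
move=> lam0 [B [mB B0 AB]].
pose phi : R -> R := fun x => lam * x + c.
have mphi : measurable_fun [set: measurableTypeR R] (phi : measurableTypeR R -> measurableTypeR R).
  apply: continuous_measurable_fun => x.
  by apply: cvgD; [apply: cvgM; [exact: cvg_cst|exact: cvg_id]|exact: cvg_cst].
pose nu := mscale (NngNum (ltW lam0))
  (@measure_function_pushforward__canonical__measure_function_Measure _ _ (measurableTypeR R)
     (measurableTypeR R) _ (@lebesgue_measure R) phi mphi).
exists (phi @^-1` B); split.
- by rewrite -[X in measurable X]setTI; exact: (mphi measurableT).
- have : mu B = nu B.
    have := @lebesgue_measure_unique R nu; apply => // X /ocitvP[->|[[a b] /= ab ->]].
      by rewrite !measure0.
    rewrite /nu /mscale /= /pushforward.
    have -> : phi @^-1` `]a, b] = `](a - c) / lam, (b - c) / lam]%classic.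
      apply/seteqP; split => x /=; rewrite !in_itv /= /phi ltr_pdivrMr // ler_pdivlMr //;
      by rewrite ltrBlDr lerBrDr mulrC.
    rewrite !lebesgue_measure_itv /= !lte_fin ab ltr_pM2r ?invr_gt0 // ltrD2r ab.
    rewrite -!EFinB -EFinM; congr EFin.
    by rewrite -mulrBl mulrCA divff ?gt_eqF // mulr1; rewrite opprB addrA subrK.
  rewrite B0 /nu /mscale /= /pushforward => /esym/eqP.
  by rewrite mule_eq0 eqe gt_eqF //= => /eqP.
- by move=> x /AB.
Qed.

(* The exceptional null set is covered by an open U of measure < r; then
   F x = (L + r) (x - s) + K mu(U `&` [s, x]) - (h x - h s) cannot stop being
   nonnegative before t: at points of U the second term absorbs the Lipschitz
   growth of h, elsewhere the derivative of h is at most L. *)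
Lemma lipschitz_ae_le h K L : 0 <= K -> 0 <= L ->
  (forall s t, 0 <= s -> 0 <= t -> `|h s - h t| <= K * `|s - t|) ->
  {ae mu, forall t, 0 <= t -> exists2 d, hl_has_derivative h t d & `|d| <= L} ->
  forall s t, 0 <= s -> s <= t -> h t - h s <= L * (t - s).
Proof.
move=> K0 L0 hK [Z [mZ Z0 badZ]] s t s0 st; apply/ler_addgt0Pl => e e0.
(* The final excess over [L * (t - s)] is at most [r * (t - s) + K * r], which is below [e]. *)
pose r := e / (t - s + K + 1).
have D0 : 0 < t - s + K + 1 by rewrite ltr_wpDl // addr_ge0 // subr_ge0.
have r0 : 0 < r by rewrite divr_gt0.
have muZ : (mu Z < +oo)%E by rewrite Z0.
have [U [oU ZU]] := lebesgue_regularity_outer mZ muZ r0.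
have mU : measurable U by exact: open_measurable.
have mUD : measurable (U `\` Z) by exact: measurableD.
have mUZ : measurable (U `&` Z) by exact: measurableI.
have UZ0 : mu (U `&` Z) = 0%E.
  by apply: (@subset_measure0 _ _ _ mu _ Z) => //; exact: subIsetr.
move=> muUD; have muU : (mu U < r%:E)%E.
  have -> : mu U = (mu (U `\` Z) + mu (U `&` Z))%E by exact: measureDI.
  by rewrite UZ0 adde0.
pose phi x := fine (mu (U `&` `[s, x])).
have mUI x : measurable (U `&` `[s, x]) by exact: measurableI.
have muUI x : (mu (U `&` `[s, x]) < r%:E)%E.
  apply: le_lt_trans muU; apply: le_measure; rewrite ?inE; [exact: mUI|exact: mU|exact: subIsetl].
have phiE x : (phi x)%:E = mu (U `&` `[s, x]).
  by rewrite fineK // ge0_fin_numE ?measure_ge0 // (lt_le_trans (muUI x)) // leey.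
have phi_le x y : x <= y -> phi x <= phi y.
  move=> xy; rewrite -lee_fin !phiE.
  apply: le_measure; rewrite ?inE; [exact: mUI|exact: mUI|apply: setIS => w /=].
  by rewrite !in_itv /= => /andP[-> /= /le_trans]; apply.
have phi_add x y : s <= x -> x <= y -> `]x, y] `<=` U -> phi x + (y - x) <= phi y.
  move=> sx xy xyU; rewrite -lee_fin EFinD !phiE.
  have -> : (y - x)%:E = mu `]x, y].
    rewrite /mu lebesgue_measure_itv /= lte_fin.
    by move: xy; rewrite le_eqVlt => /orP[/eqP->|->]; rewrite ?ltxx ?subrr ?EFinB.
  have -> : (mu (U `&` `[s, x]) + mu `]x, y])%E = mu ((U `&` `[s, x]) `|` `]x, y]).
    apply/esym/measureU; [exact: mUI|exact: measurable_itv|].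
    rewrite -subset0 => w [[_ /=]]; rewrite !in_itv /= => /andP[_ wx] /andP[xw _].
    by move: xw; rewrite ltNge wx.
  apply: le_measure; rewrite ?inE; [|exact: mUI|].
    by apply: measurableU; [exact: mUI|exact: measurable_itv].
  move=> w [[Uw /=]|/= wxy]; rewrite !in_itv /=.
    by move=> /andP[-> wx]; split => //=; exact: le_trans xy.
  split; first exact: xyU.
  by move: wxy; rewrite in_itv /= => /andP[/ltW xw ->]; rewrite (le_trans sx).
have phi_r x : phi x <= r by rewrite -lee_fin phiE ltW.
have phi0 x : 0 <= phi x by exact: fine_ge0.
pose F x := (L + r) * (x - s) + K * phi x - (h x - h s).
pose S := [set x | s <= x <= t /\ 0 <= F x].
have Ss : S s by rewrite /S /= lexx st /F !subrr mulr0 add0r subr0 mulr_ge0.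
have hS : has_sup S.
  by split; [exists s|exists t => x [/andP[_ ?] _]].
pose z := sup S.
have sz : s <= z by exact: sup_upper_bound.
have zt : z <= t by apply: ge_sup; [exists s|move=> x [/andP[_ ?] _]].
(* The supremum belongs to [S]: [phi] is nondecreasing and [h] is Lipschitz, so between a nearby [x]
   in [S] and [z] the value of [F] drops by at most [q]. *)
have Fz : 0 <= F z.
  apply/ler_addgt0Pl => q q0.
  have q0' : 0 < q / (K + 1) by rewrite divr_gt0 // ltr_wpDl.
  have [x Sx xz] := sup_adherent q0' hS.
  have xz' : x <= z by exact: sup_upper_bound.
  case: Sx => /andP[sx xt] Fx.
  have h1 := hK _ _ (le_trans s0 sz) (le_trans s0 sx).
  have h2 := ler_norm (h z - h x).
  have h3 : K * (z - x) <= q.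
    have : z - x <= q / (K + 1) by rewrite /z; lra.
    rewrite ler_pdivlMr ?ltr_wpDl // mulrDr mulr1 mulrC.
    by move: xz'; rewrite -subr_ge0; lra.
  have h4 := ler_wpM2l K0 (phi_le _ _ xz').
  have h5 : (L + r) * (x - s) <= (L + r) * (z - s).
    by rewrite ler_wpM2l ?lerD2r // addr_ge0 // ltW.
  rewrite [`|z - x|]ger0_norm ?subr_ge0 // in h1.
  by rewrite /F in Fx *; lra.
have zeq : z = t.
  apply/eqP; rewrite eq_le zt /= leNgt; apply/negP => zlt.
  suff [y [zy yt Fy]] : exists y, [/\ z < y, y <= t & 0 <= F y].
    have : y <= z by apply: sup_upper_bound => //; split; rewrite // yt ltW // (le_lt_trans sz).
    by rewrite leNgt zy.
  have z0 : 0 <= z := le_trans s0 sz.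
  have [Zz|nZz] := pselect (Z z).
    have := oU z (ZU z Zz) => -[del /= del0 zU].
    pose y := Num.min (z + del / 2) t.
    have zy : z < y by rewrite lt_min zlt andbT; lra.
    have yd : y <= z + del / 2 by rewrite ge_min lexx.
    exists y; split => //; first by rewrite ge_min lexx orbT.
    have := phi_add z y sz (ltW zy) => /(_ _) H.
    have {}H : phi z + (y - z) <= phi y.
      apply: H => x /=; rewrite in_itv /= => /andP[zx xy]; apply: zU.
      by rewrite /ball_ /= ltr_distlC; apply/andP; split; lra.
    have h1 := hK _ _ (le_trans z0 (ltW zy)) z0.
    rewrite [`|y - z|]ger0_norm ?subr_ge0 ?(ltW zy) // in h1.
    have h2 := ler_norm (h y - h z).
    have h4 := ler_wpM2l K0 H; rewrite mulrDr in h4.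
    have h5 : (L + r) * (z - s) <= (L + r) * (y - s).
      by rewrite ler_wpM2l ?lerD2r ?(ltW zy) // addr_ge0 // ltW.
    by rewrite /F in Fz *; lra.
  have [d hd dL] : exists2 d, hl_has_derivative h z d & `|d| <= L.
    apply: contrapT => H; apply: nZz; apply: badZ => /= H'; apply: H.
    exact: H'.
  have [del del0 H] := hd r r0.
  pose y := Num.min (z + del / 2) t.
  have zy : z < y by rewrite lt_min zlt andbT; lra.
  have yd : y <= z + del / 2 by rewrite ge_min lexx.
  exists y; split => //; first by rewrite ge_min lexx orbT.
  have := H y (le_trans z0 (ltW zy)).
  rewrite ger0_norm ?subr_ge0 ?(ltW zy) // => /(_ _) h1.
  have {}h1 := h1 _; have {}h1 := h1 ltac:(lra).
  have h2 := le_trans (ler_norm _) h1.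
  have h3 : d * (y - z) <= L * (y - z).
    by rewrite ler_wpM2r ?(le_trans (ler_norm _) dL) // subr_ge0 ltW.
  have h4 := ler_wpM2l K0 (phi_le _ _ (ltW zy)).
  by rewrite /F in Fz *; lra.
move: Fz; rewrite zeq /F => Ft.
have h1 := ler_wpM2l K0 (phi_r t).
have h2 : r * (t - s + K + 1) = e by rewrite /r divfK // gt_eqF.
by lra.
Qed.

End AlmostEverywhere.

(** * The classes of signals *)

Section SmoothClasses.
Variables (R : realType) (m : nat).
Implicit Types (f g : R -> R) (s t d e K L : R).

#[local] Instance lebesgue_ae_filter :
  Filter (nbhs (almost_everywhere (@lebesgue_measure R))) := ae_filter_ringOfSetsType _.

Definition hl_lipschitz K f := forall s t, 0 <= s -> 0 <= t ->
  `|f s - f t| <= K * `|s - t|.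

(** Iterated derivatives are identified by exhibiting a chain of candidates. They agree at
    nonnegative times only, which suffices because difference quotients see no other values. *)
Lemma hl_deriven_chain (g : nat -> R -> R) :
  (forall k t, (k < m)%N -> 0 <= t -> hl_has_derivative (g k) t (g k.+1 t)) ->
  forall k t, (k <= m)%N -> 0 <= t -> hl_deriven k (g 0%N) t = g k t.
Proof.
move=> gD; elim=> [//|k IH] t km t0; rewrite /hl_deriven iterS.
apply: hl_deriveE => //.
apply: (@eq_hl_has_derivative _ (g k)) => //; last exact: gD.
by move=> s s0; rewrite -IH // ltnW.
Qed.

(** Membership is certified by explicit candidates for the derivatives; [K] may be any Lipschitz
    constant, unrelated to [L]. *)
Lemma smooth_class_le_intro L K (g : nat -> R -> R) : 0 <= K ->
  (forall k t, (k < m)%N -> 0 <= t -> hl_has_derivative (g k) t (g k.+1 t)) ->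
  hl_lipschitz K (g m) ->
  {ae lebesgue_measure, forall t, 0 <= t ->
    exists2 d, hl_has_derivative (g m) t d & `|d| <= L} ->
  smooth_class_le m L (g 0%N).
Proof.
move=> K0 gD gK gae; have gE := hl_deriven_chain gD.
have gmE s : 0 <= s -> g m s = hl_deriven m (g 0%N) s by move=> s0; rewrite gE.
have gmK : hl_lipschitz K (hl_deriven m (g 0%N)).
  by move=> s t s0 t0; rewrite -!gmE //; exact: gK.
split; first split.
- move=> k t km t0; apply/hl_derivableP => //.
  have -> : hl_derive (hl_deriven k (g 0%N)) t = g k.+1 t by rewrite -gE.
  apply: (@eq_hl_has_derivative _ (g k)) => //; last exact: gD.
  by move=> s s0; rewrite gE // ltnW.
- apply/subspace_continuousP => t; rewrite /= in_itv /= andbT => t0.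
  apply/cvgrPdist_le => e e0; rewrite near_withinE.
  have K1 : 0 < K + 1 by rewrite ltr_wpDl.
  exists (e / (K + 1)) => /=; first by rewrite divr_gt0.
  move=> s; rewrite /ball_ /= in_itv /= andbT ltr_pdivlMr // => st s0.
  apply: (le_trans (gmK t s t0 s0)); apply: le_trans (ltW st).
  by rewrite mulrC ler_wpM2l // lerDl.
- exists K; split; first exact: num_real.
  move=> M KM [s t] /=; rewrite !in_itv /= !andbT => -[s0 t0].
  apply: (le_trans (gmK s t s0 t0)).
  by rewrite ler_wpM2r // ltW.
apply: filterS gae => t H t0; have [d gd dL] := H t0.
have {}gd : hl_has_derivative (hl_deriven m (g 0%N)) t d.
  exact: eq_hl_has_derivative gd.
have E := hl_deriveE t0 gd.
by rewrite hl_derivableP // /hl_deriven iterS E.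
Qed.

Lemma smooth_class_le_has_derivative L f k t : smooth_class_le m L f ->
  (k < m)%N -> 0 <= t -> hl_has_derivative (hl_deriven k f) t (hl_deriven k.+1 f t).
Proof. by move=> [[fD _ _] _] km t0; apply/hl_derivableP => //; exact: fD. Qed.

Lemma smooth_class_le_ae L f : smooth_class_le m L f ->
  {ae lebesgue_measure, forall t, 0 <= t ->
    exists2 d, hl_has_derivative (hl_deriven m f) t d & `|d| <= L}.
Proof.
move=> [_]; apply: filterS => t H t0; have [/hl_derivableP fD fL] := H t0.
by exists (hl_deriven m.+1 f t) => //; exact: fD.
Qed.

Lemma smooth_class_le_lipschitz_ex L f : smooth_class_le m L f ->
  exists2 K, 0 <= K & hl_lipschitz K (hl_deriven m f).
Proof.
move=> [[_ _ [M [_ fM]]] _]; pose K := Num.max (M + 1) 0.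
exists K; first by rewrite le_max lexx orbT.
move=> s t s0 t0; have MK : M < K by rewrite lt_max ltrDl ltr01.
by have /= := fM K MK (s, t); rewrite !in_itv /= !andbT; apply.
Qed.

(** The almost everywhere bound sharpens an arbitrary Lipschitz constant to [L]: [lipschitz_ae_le]
    is applied to the derivative of order [m] and to its negative. *)
Lemma smooth_class_le_lipschitz L f : 0 <= L -> smooth_class_le m L f ->
  hl_lipschitz L (hl_deriven m f).
Proof.
move=> L0 fL; have [K K0 fK] := smooth_class_le_lipschitz_ex fL.
have fae := smooth_class_le_ae fL.
(* The negative is written as a linear combination so that [hl_has_derivative_lin] applies to it. *)
have fKN : hl_lipschitz K (fun s => -1 * hl_deriven m f s + 0 * hl_deriven m f s).
  by move=> s t s0 t0; rewrite !mul0r !addr0 -mulrBr mulN1r normrN; exact: fK.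
have le_st s t : 0 <= s -> s <= t ->
    `|hl_deriven m f t - hl_deriven m f s| <= L * (t - s).
  move=> s0 st; rewrite ler_norml; apply/andP; split; last exact: (lipschitz_ae_le K0 L0 fK fae).
  have := lipschitz_ae_le K0 L0 fKN _ s0 st.
  rewrite !mul0r !addr0 -mulrBr mulN1r lerNl; apply.
  apply: filterS fae => x H x0; have [d fd dL] := H x0.
  exists (-1 * d + 0 * d); first exact: hl_has_derivative_lin.
  by rewrite mul0r addr0 mulN1r normrN.
move=> s t s0 t0; have [st|/ltW ts] := leP s t.
  by rewrite distrC [`|s - t|]distrC [`|t - s|]ger0_norm ?subr_ge0 // le_st.
by rewrite [`|s - t|]ger0_norm ?subr_ge0 // le_st.
Qed.

Lemma smooth_class_leW L L' f : L <= L' -> smooth_class_le m L f -> smooth_class_le m L' f.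
Proof.
move=> LL' [fm fae]; split => //; apply: filterS fae => t H t0.
by have [fD fL] := H t0; split => //; exact: le_trans fL LL'.
Qed.

Let lin_has_derivative a b f g L1 L2 :
  smooth_class_le m L1 f -> smooth_class_le m L2 g ->
  let h k t := a * hl_deriven k f t + b * hl_deriven k g t in
  forall k t, (k < m)%N -> 0 <= t -> hl_has_derivative (h k) t (h k.+1 t).
Proof.
move=> fL gL h k t km t0; apply: hl_has_derivative_lin.
  exact: smooth_class_le_has_derivative fL km t0.
exact: smooth_class_le_has_derivative gL km t0.
Qed.

Lemma hl_deriven_lin a b f g L1 L2 k t :
  smooth_class_le m L1 f -> smooth_class_le m L2 g -> (k <= m)%N -> 0 <= t ->
  hl_deriven k (fun s => a * f s + b * g s) t =
  a * hl_deriven k f t + b * hl_deriven k g t.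
Proof.
by move=> fL gL km t0; have := hl_deriven_chain (lin_has_derivative a b fL gL) km t0.
Qed.

Lemma smooth_class_le_lin a b f g L1 L2 L :
  smooth_class_le m L1 f -> smooth_class_le m L2 g ->
  `|a| * L1 + `|b| * L2 <= L ->
  smooth_class_le m L (fun s => a * f s + b * g s).
Proof.
move=> fL gL abL.
have [K1 K10 fK] := smooth_class_le_lipschitz_ex fL.
have [K2 K20 gK] := smooth_class_le_lipschitz_ex gL.
apply: (@smooth_class_le_intro L (`|a| * K1 + `|b| * K2)
  (fun k t => a * hl_deriven k f t + b * hl_deriven k g t)).
- by rewrite addr_ge0 // mulr_ge0.
- exact: lin_has_derivative fL gL.
- move=> s t s0 t0; rewrite opprD addrACA -!mulrBr.
  rewrite (le_trans (ler_normD _ _)) // !normrM mulrDl -!mulrA.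
  by rewrite lerD // ler_wpM2l // ?fK ?gK.
apply: filterS2 (smooth_class_le_ae fL) (smooth_class_le_ae gL) => t Hf Hg t0.
have [d1 fd d1L] := Hf t0; have [d2 gd d2L] := Hg t0.
exists (a * d1 + b * d2); first exact: hl_has_derivative_lin.
apply: le_trans abL; rewrite (le_trans (ler_normD _ _)) // !normrM.
by rewrite lerD // ler_wpM2l.
Qed.

(** * Signals under rescaling and shift of time *)

Section Affine.
Variables (lam c L : R) (f : R -> R).
Hypotheses (lam0 : 0 < lam) (c0 : 0 <= c) (fL : smooth_class_le m L f).

Let affine_ge0 t : 0 <= t -> 0 <= lam * t + c.
Proof. by move=> t0; rewrite addr_ge0 // mulr_ge0 // ltW. Qed.

Let h k t := lam ^+ k * hl_deriven k f (lam * t + c).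

Let h_has_derivative k t d : 0 <= t ->
  hl_has_derivative (hl_deriven k f) (lam * t + c) d ->
  hl_has_derivative (h k) t (lam ^+ k.+1 * d).
Proof.
move=> t0 fd; have fd' := hl_has_derivative_affine lam0 c0 fd.
have := hl_has_derivative_lin (lam ^+ k) 0 fd' fd'.
rewrite mul0r addr0 mulrA -exprSr; apply: eq_hl_has_derivative => //.
by move=> s _; rewrite mul0r addr0.
Qed.

Let h_chain k t : (k < m)%N -> 0 <= t -> hl_has_derivative (h k) t (h k.+1 t).
Proof.
move=> km t0; apply: h_has_derivative => //.
exact: smooth_class_le_has_derivative fL km (affine_ge0 t0).
Qed.

Let h0E : h 0 = fun t => f (lam * t + c).
Proof. by apply/funext => t; rewrite /h expr0 mul1r. Qed.

Lemma hl_deriven_affine k t : (k <= m)%N -> 0 <= t ->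
  hl_deriven k (fun s => f (lam * s + c)) t = lam ^+ k * hl_deriven k f (lam * t + c).
Proof. by rewrite -h0E; exact: hl_deriven_chain. Qed.

Lemma smooth_class_le_affine :
  smooth_class_le m (lam ^+ m.+1 * L) (fun s => f (lam * s + c)).
Proof.
have [K K0 fK] := smooth_class_le_lipschitz_ex fL.
have lamX k : 0 <= lam ^+ k by rewrite exprn_ge0 // ltW.
rewrite -h0E; apply: (@smooth_class_le_intro _ (lam ^+ m.+1 * K) h).
- by rewrite mulr_ge0.
- exact: h_chain.
- move=> s t s0 t0; rewrite /h -mulrBr normrM ger0_norm // exprSr -!mulrA.
  rewrite ler_wpM2l //; apply: (le_trans (fK _ _ _ _)); rewrite ?affine_ge0 //.
  have -> : lam * s + c - (lam * t + c) = lam * (s - t) by ring.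
  by rewrite normrM gtr0_norm // mulrCA.
have fae := lebesgue_negligible_affine c lam0 (smooth_class_le_ae fL).
apply: (negligibleS _ fae) => t /= H H'; apply: H => t0.
have [d fd dL] := H' (affine_ge0 t0).
exists (lam ^+ m.+1 * d); first exact: h_has_derivative.
by rewrite normrM ger0_norm // ler_wpM2l.
Qed.

End Affine.

(** * Sinusoidal signals *)

Section Sine.
Variables (A c : R).

(** Each differentiation advances the phase by a quarter period, so all derivatives are bounded by
    the amplitude. *)
Let h k t := A * sin (t + c + k%:R * (pi / 2)).

Let sin_has_derivative k t : hl_has_derivative (h k) t (h k.+1 t).
Proof.
apply: is_derive_hl_has_derivative; rewrite /h.
pose b := c + k%:R * (pi / 2).
have -> : (fun s => A * sin (s + c + k%:R * (pi / 2))) = A *: (sin \o (fun s => s + b)).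
  by apply/funext => s /=; rewrite -addrA.
apply: is_derive_eq.
have -> : t + c + k.+1%:R * (pi / 2) = t + b + pi / 2.
  by rewrite /b -natr1; ring.
by rewrite sinDpihalf addr0 mulr1.
Qed.

Lemma hl_deriven_sin k t : (k <= m)%N -> 0 <= t ->
  hl_deriven k (fun s => A * sin (s + c)) t = A * sin (t + c + k%:R * (pi / 2)).
Proof.
have -> : (fun s => A * sin (s + c)) = h 0 by apply/funext => s; rewrite /h mul0r addr0.
by apply: hl_deriven_chain => *; exact: sin_has_derivative.
Qed.

Lemma smooth_class_le_sin L : `|A| <= L -> smooth_class_le m L (fun s => A * sin (s + c)).
Proof.
move=> AL; have h_le k t : `|h k t| <= `|A|.
  by rewrite normrM ler_piMr // ler_norml sin_geN1 sin_le1.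
have -> : (fun s => A * sin (s + c)) = h 0 by apply/funext => s; rewrite /h mul0r addr0.
apply: (@smooth_class_le_intro L `|A| h) => //.
- have le_st s t : 0 <= s -> s <= t -> `|h m t - h m s| <= `|A| * (t - s).
    by move=> s0 st; apply: (@hl_MVT_le _ _ (h m.+1)).
  move=> s t s0 t0; have [st|/ltW ts] := leP s t.
    by rewrite distrC [`|s - t|]distrC [`|t - s|]ger0_norm ?subr_ge0 // le_st.
  by rewrite [`|s - t|]ger0_norm ?subr_ge0 // le_st.
apply: aeW => t t0; exists (h m.+1 t) => //; exact: le_trans AL.
Qed.

End Sine.

End SmoothClasses.

(** * The bound gbar *)

Section DerivativeBounds.
Variables (R : realType) (m : nat).
Implicit Types (f g : R -> R) (s t w a L N T B C : R).

(* Induction on j: apply the mean value theorem between two points with small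
   j-th derivative in the first and last thirds of the interval. *)
Lemma small_derivative_point N j : 0 <= N -> (j <= m)%N ->
  forall w, 0 < w -> exists2 C, 0 <= C & forall L g a,
    smooth_class_le m L g -> 0 <= a ->
    (forall t, a <= t <= a + w -> `|g t| <= N) ->
    exists2 x, a <= x <= a + w & `|hl_deriven j g x| <= C.
Proof.
move=> N0; elim: j => [_|j IH jm] w w0.
  exists N => // L g a _ _ gN; exists a; first by lra.
  by apply: gN; lra.
have w3 : 0 < w / 3 by lra.
have [C C0 H] := IH (ltnW jm) _ w3.
(* The two points are at least [w / 3] apart and the values there differ by at most [2 * C]. *)
exists (6 * C / w) => [|L g a gL a0 gN]; first by rewrite divr_ge0 ?mulr_ge0 // ltW.
have [x /andP[ax xa] xC] : exists2 x, a <= x <= a + w / 3 & `|hl_deriven j g x| <= C.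
  by apply: (H L) => // t /andP[t1 t2]; apply: gN; lra.
have [y /andP[ay ya] yC] : exists2 y, a + 2 * (w / 3) <= y <= a + 2 * (w / 3) + w / 3
    & `|hl_deriven j g y| <= C.
  by apply: (H L) => //; [lra|move=> t /andP[t1 t2]; apply: gN; lra].
have x0 : 0 <= x by lra.
have xy : x < y by lra.
have [z /andP[xz zy] zE] := @hl_MVT R (hl_deriven j g) (hl_deriven j.+1 g) x y x0 xy
  (fun t h => smooth_class_le_has_derivative gL jm (le_trans x0 (proj1 (andP h)))).
exists z; first by lra.
rewrite ler_pdivlMr //.
have h1 : `|hl_deriven j.+1 g z| * (y - x) <= 2 * C.
  have -> : `|hl_deriven j.+1 g z| * (y - x) = `|hl_deriven j.+1 g z * (y - x)|.
    by rewrite normrM [`|y - x|]gtr0_norm // subr_gt0.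
  by rewrite -zE (le_trans (ler_normB _ _)) //; lra.
have h2 : `|hl_deriven j.+1 g z| * (w / 3) <= `|hl_deriven j.+1 g z| * (y - x).
  by rewrite ler_wpM2l //; lra.
by lra.
Qed.

(** Downward induction on the order, from [m]: each derivative is small at some point of [0, T], and
    varies by at most [T] times the Lipschitz constant [L] (order [m]) or the bound on the next
    derivative (lower orders). *)
Lemma bounded_upto_deriven_le L N T k : 0 <= L -> 0 <= N -> 0 < T -> (k <= m)%N ->
  exists2 B, 0 <= B & forall g, bounded_upto m L N T g ->
    forall t, 0 <= t <= T -> `|hl_deriven k g t| <= B.
Proof.
move=> L0 N0 T0 km; rewrite -(subKn km); elim: (m - k)%N => [|i [B B0 IH]].
  rewrite subn0; have [C C0 H] := small_derivative_point N0 (leqnn m) T0.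
  exists (C + L * T) => [|g [gL gN] t /andP[t0 tT]].
    by rewrite addr_ge0 // mulr_ge0 // ltW.
  have [x] := H L g 0 gL (lexx 0) ltac:(by rewrite add0r).
  rewrite add0r => /andP[x0 xT] xC.
  have h1 := smooth_class_le_lipschitz L0 gL t0 x0.
  have xt : `|t - x| <= T by rewrite ler_norml; lra.
  have h2 := ler_wpM2l L0 xt.
  rewrite -[hl_deriven m g t](subrK (hl_deriven m g x)).
  by rewrite (le_trans (ler_normD _ _)) //; lra.
(* For [i >= m] the truncated differences [m - i] and [m - i.+1] are both 0, and the previous bound
   carries over. *)
have [im|mi] := ltnP i m; last first.
  exists B => // g gG t tT; have := IH g gG t tT.
  move: (mi); rewrite -subn_eq0 => /eqP ->; rewrite subnS.
  by move: mi; rewrite -subn_eq0 => /eqP ->.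
have jm : (m - i.+1 < m)%N by rewrite subnSK // leq_subr.
have [C C0 H] := small_derivative_point N0 (ltnW jm) T0.
exists (C + B * T) => [|g [gL gN] t /andP[t0 tT]].
  by rewrite addr_ge0 // mulr_ge0 // ltW.
have [x] := H L g 0 gL (lexx 0) ltac:(by rewrite add0r).
rewrite add0r => /andP[x0 xT] xC.
have dB s1 s2 : 0 <= s1 -> s1 <= s2 -> s2 <= T ->
    `|hl_deriven (m - i.+1) g s2 - hl_deriven (m - i.+1) g s1| <= B * T.
  move=> s10 s12 s2T.
  apply: (@le_trans _ _ (B * (s2 - s1))); last by rewrite ler_wpM2l //; lra.
  apply: (@hl_MVT_le _ _ (hl_deriven (m - i.+1).+1 g)) => // u /andP[u1 u2].
    by apply: smooth_class_le_has_derivative gL jm _; exact: le_trans u1.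
  by rewrite subnSK //; apply: IH => //; lra.
have h : `|hl_deriven (m - i.+1) g t - hl_deriven (m - i.+1) g x| <= B * T.
  by have [xt|/ltW tx] := leP x t; [|rewrite distrC]; exact: dB.
rewrite -[hl_deriven (m - i.+1) g t](subrK (hl_deriven (m - i.+1) g x)).
by rewrite (le_trans (ler_normD _ _)) //; lra.
Qed.

(** A real-valued version of [gbar], so that ordinary arithmetic applies; [gbarrE] shows that no
    value is lost to [fine]. *)
Definition gbarr L N k T : R := fine (gbar m L N k T).

Lemma bounded_upto_sin L N T A c : `|A| <= L -> `|A| <= N ->
  bounded_upto m L N T (fun s => A * sin (s + c)).
Proof.
move=> AL AN; split; first exact: smooth_class_le_sin.
by move=> t _; rewrite normrM (le_trans _ AN) // ler_piMr // ler_norml sin_geN1 sin_le1.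
Qed.

Section Gbar.
Variables (L N T : R) (k : nat).
Hypotheses (L0 : 0 <= L) (N0 : 0 <= N) (T0 : 0 < T) (km : (k <= m)%N).

Lemma gbarrE : (gbarr L N k T)%:E = gbar m L N k T.
Proof.
rewrite fineK // fin_numElt; apply/andP; split.
  (* The sine of amplitude 0 serves as the zero signal. *)
  apply: (@lt_le_trans _ _ (hl_deriven k (fun s => 0 * sin (s + 0)) T)%:E); first exact: ltNyr.
  apply: ereal_sup_ubound; exists (fun s => 0 * sin (s + 0)) => //.
  by apply: bounded_upto_sin; rewrite normr0.
have [B B0 H] := bounded_upto_deriven_le L0 N0 T0 km.
apply: (@le_lt_trans _ _ B%:E); last exact: ltry.
apply: ge_ereal_sup => _ [g gG <-]; rewrite lee_fin (le_trans (ler_norm _)) //.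
by apply: H => //; rewrite lexx ltW.
Qed.

Lemma le_gbarr g : bounded_upto m L N T g -> hl_deriven k g T <= gbarr L N k T.
Proof. by move=> gG; rewrite -lee_fin gbarrE; apply: ereal_sup_ubound; exists g. Qed.

Lemma gbarr_le c : (forall g, bounded_upto m L N T g -> hl_deriven k g T <= c) ->
  gbarr L N k T <= c.
Proof.
move=> H; rewrite -lee_fin gbarrE; apply: ge_ereal_sup => _ [g gG <-].
by rewrite lee_fin; exact: H.
Qed.

Lemma gbarr_ge0 : 0 <= gbarr L N k T.
Proof.
have := @le_gbarr (fun s => 0 * sin (s + 0)).
by rewrite (@hl_deriven_sin R m) ?(ltW T0) // mul0r; apply; apply: bounded_upto_sin; rewrite normr0.
Qed.

End Gbar.

(** A competitor [g] for (L, N) yields the competitor [alpha * g]; for [alpha = 0] the claim is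
    nonnegativity. *)
Lemma gbarr_homogeneous alpha L N T k :
  0 <= L -> 0 <= N -> 0 < T -> (k <= m)%N -> 0 <= alpha ->
  alpha * gbarr L N k T <= gbarr (alpha * L) (alpha * N) k T.
Proof.
move=> L0 N0 T0 km; rewrite le_eqVlt => /orP[/eqP <-|al0].
  by rewrite mul0r gbarr_ge0 ?mul0r.
rewrite mulrC -ler_pdivlMr //; apply: gbarr_le => // g [gL gN].
rewrite ler_pdivlMr // mulrC.
have := @le_gbarr (alpha * L) (alpha * N) T k _ _ T0 km (fun s => alpha * g s + 0 * g s).
rewrite (hl_deriven_lin _ _ gL gL km (ltW T0)) mul0r addr0; apply.
- by rewrite mulr_ge0 // ltW.
- by rewrite mulr_ge0 // ltW.
split; first by apply: (smooth_class_le_lin gL gL); rewrite normr0 mul0r addr0 gtr0_norm.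
by move=> t tT; rewrite mul0r addr0 normrM gtr0_norm // ler_pM2l // gN.
Qed.

(** The last stretch of [0, T'], of length [lam * T], is reparametrized over [0, T]. The case
    [lam = 1] gives monotonicity in time, the case [T' = lam * T] the scaling in [L]. *)
Lemma gbarr_affine lam L N T T' k :
  0 <= L -> 0 <= N -> 0 < T -> (k <= m)%N -> 0 < lam -> lam * T <= T' ->
  lam ^+ k * gbarr L N k T' <= gbarr (lam ^+ m.+1 * L) N k T.
Proof.
move=> L0 N0 T0 km lam0 TT'.
have T'0 : 0 < T' by apply: lt_le_trans TT'; rewrite mulr_gt0.
have lamk : 0 < lam ^+ k by rewrite exprn_gt0.
have c0 : 0 <= T' - lam * T by rewrite subr_ge0.
have TE : lam * T + (T' - lam * T) = T' by rewrite addrC subrK.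
rewrite mulrC -ler_pdivlMr //; apply: gbarr_le => // g [gL gN].
rewrite ler_pdivlMr // mulrC.
have := @le_gbarr (lam ^+ m.+1 * L) N T k _ N0 T0 km (fun s => g (lam * s + (T' - lam * T))).
rewrite (hl_deriven_affine lam0 c0 gL km (ltW T0)) TE; apply.
  by rewrite mulr_ge0 // exprn_ge0 // ltW.
split; first exact: smooth_class_le_affine.
move=> t /andP[t0 tT]; apply: gN; apply/andP; split.
  by rewrite addr_ge0 // mulr_ge0 // ltW.
by rewrite addrCA gerDl -mulrBr mulr_ge0_le0 // ?(ltW lam0) // subr_le0.
Qed.

Lemma gbarr_nonincreasing L N T T' k :
  0 <= L -> 0 <= N -> 0 < T -> (k <= m)%N -> T <= T' ->
  gbarr L N k T' <= gbarr L N k T.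
Proof.
move=> L0 N0 T0 km TT'; have := @gbarr_affine 1 L N T T' k L0 N0 T0 km ltr01.
by rewrite !expr1n !mul1r; apply.
Qed.

(** A competitor vanishes on [0, T], hence so do its left difference quotients at [T]. *)
Lemma gbarr_noiseless L T : (0 < m)%N -> 0 <= L -> 0 < T -> gbarr L 0 1 T <= 0.
Proof.
move=> m0 L0 T0; apply: gbarr_le => // g [gL g0].
have g0' t : 0 <= t <= T -> g t = 0.
  by move=> /g0; rewrite normr_le0 => /eqP.
apply/ler_addgt0Pr => e e0; rewrite add0r.
have [del del0 H] := smooth_class_le_has_derivative gL m0 (ltW T0) e0.
pose x := Num.min (del / 2) T.
have x0 : 0 < x by rewrite lt_min T0 andbT divr_gt0.
have xd : x <= del / 2 by rewrite ge_min lexx.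
have xT : x <= T by rewrite ge_min lexx orbT.
have := H (T - x).
have -> : T - x - T = - x by ring.
rewrite normrN [`|x|]gtr0_norm // /hl_deriven /= !g0' ?subrr ?sub0r; [|lra|lra].
rewrite mulrN opprK normrM [`|x|]gtr0_norm // => H1.
have {}H1 := H1 ltac:(lra) ltac:(lra).
by rewrite (le_trans (ler_norm _)) // -(ler_pM2r x0).
Qed.

End DerivativeBounds.

(** * The infimum of gbar over all times *)

(** Induction on the exponent, multiplying by the midpoint; the loss in each step is a multiple of
    [(b ^+ k - a ^+ k) * (b - a)], which is positive in the last one. *)
Lemma expr_midpoint_lt (R : realFieldType) n (a b : R) : (1 < n)%N -> 0 <= a -> 0 <= b ->
  a != b -> ((a + b) / 2) ^+ n < (a ^+ n + b ^+ n) / 2.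
Proof.
wlog ab : a b / a < b => [H n1 a0 b0 ab|].
  move: (ab); rewrite neq_lt => /orP[ltab|ltba]; first exact: H.
  by rewrite [a + b]addrC [a ^+ n + _]addrC; apply: H => //; rewrite eq_sym.
case: n => [//|n] n0 a0 b0 _.
have c0 : 0 <= (a + b) / 2 by lra.
have step k : a ^+ k <= b ^+ k -> (a ^+ k + b ^+ k) / 2 * ((a + b) / 2) <=
    (a ^+ k.+1 + b ^+ k.+1) / 2.
  by move=> abk; rewrite !exprSr; nra.
have weak k : ((a + b) / 2) ^+ k <= (a ^+ k + b ^+ k) / 2.
  elim: k => [|k IH]; first by rewrite !expr0; lra.
  rewrite exprSr (le_trans (ler_wpM2r c0 IH)) // step //.
  by rewrite lerXn2r ?nnegrE // ltW.
apply: (@le_lt_trans _ _ ((a ^+ n + b ^+ n) / 2 * ((a + b) / 2))).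
  by rewrite exprSr ler_wpM2r.
have abn : a ^+ n < b ^+ n by rewrite ltrXn2r // -lt0n.
by rewrite !exprSr; nra.
Qed.

Section LongTimeBound.
Variables (R : realType) (m : nat).
Hypothesis m0 : (0 < m)%N.
Implicit Types (L N T X c x y lam : R).

(** The quantity Phi; by monotonicity in [T], it is the limit of the bound for large times. *)
Definition gbarr_inf L N : R :=
  inf [set gbarr m L N 1 T | T in [set T | 0 < T]].

Let gbarr_has_inf L N : 0 <= L -> 0 <= N ->
  has_inf [set gbarr m L N 1 T | T in [set T | 0 < T]].
Proof.
move=> L0 N0; split; first by exists (gbarr m L N 1 1); exists 1 => //=.
by exists 0 => _ [T T0 <-]; exact: gbarr_ge0.
Qed.

Lemma gbarr_inf_le L N T : 0 <= L -> 0 <= N -> 0 < T ->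
  gbarr_inf L N <= gbarr m L N 1 T.
Proof.
by move=> L0 N0 T0; apply: ge_inf; [case: (gbarr_has_inf L0 N0)|exists T].
Qed.

Lemma le_gbarr_inf L N c : 0 <= L -> 0 <= N ->
  (forall T, 0 < T -> c <= gbarr m L N 1 T) -> c <= gbarr_inf L N.
Proof.
move=> L0 N0 H; apply: lb_le_inf; first by case: (gbarr_has_inf L0 N0).
by move=> _ [T T0 <-]; exact: H.
Qed.

Lemma gbarr_inf_scale lam L N : 0 <= L -> 0 <= N -> 0 < lam ->
  lam * gbarr_inf L N <= gbarr_inf (lam ^+ m.+1 * L) N.
Proof.
move=> L0 N0 lam0; apply: le_gbarr_inf => // [|T T0].
  by rewrite mulr_ge0 // exprn_ge0 // ltW.
apply: le_trans (gbarr_affine L0 N0 T0 m0 lam0 (lexx _)).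
by rewrite expr1 ler_pM2l // gbarr_inf_le // mulr_gt0.
Qed.

Lemma gbarr_inf_homogeneous alpha L N : 0 <= L -> 0 <= N -> 0 <= alpha ->
  alpha * gbarr_inf L N <= gbarr_inf (alpha * L) (alpha * N).
Proof.
move=> L0 N0 al0; apply: le_gbarr_inf => [||T T0]; rewrite ?mulr_ge0 //.
apply: le_trans (gbarr_homogeneous L0 N0 T0 m0 al0).
by rewrite ler_wpM2l // gbarr_inf_le.
Qed.

Lemma gbarr_inf_mono L L' N : 0 <= L -> L <= L' -> 0 <= N ->
  gbarr_inf L N <= gbarr_inf L' N.
Proof.
move=> L0 LL' N0; have L'0 := le_trans L0 LL'.
apply: le_gbarr_inf => // T T0; apply: (le_trans (gbarr_inf_le L0 N0 T0)).
apply: gbarr_le => // g [gL gN]; apply: le_gbarr => //; split => //.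
exact: smooth_class_leW LL' gL.
Qed.

Lemma gbarr_inf_subadd L1 N1 L2 N2 L3 N3 :
  0 <= L1 -> 0 <= N1 -> 0 <= L2 -> 0 <= N2 -> 0 <= L3 -> 0 <= N3 ->
  (forall T, 0 < T -> gbarr m L3 N3 1 T <= gbarr m L1 N1 1 T + gbarr m L2 N2 1 T) ->
  gbarr_inf L3 N3 <= gbarr_inf L1 N1 + gbarr_inf L2 N2.
Proof.
move=> L10 N10 L20 N20 L30 N30 H.
rewrite -lerBlDr; apply: le_gbarr_inf => // T1 T10.
rewrite lerBlDr addrC -lerBlDr; apply: le_gbarr_inf => // T2 T20.
(* Monotonicity in time allows both bounds to be compared at the later of the two times. *)
have T0 : 0 < Num.max T1 T2 by rewrite lt_max T10.
rewrite lerBlDr (le_trans (gbarr_inf_le L30 N30 T0)) // (le_trans (H _ T0)) //.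
by rewrite addrC lerD // gbarr_nonincreasing // le_max lexx ?orbT.
Qed.

(** For every [T], a sine with phase [- T] has slope [A] at [T], and [A] is within both bounds. *)
Lemma gbarr_inf_gt0 N : 0 < N -> 0 < gbarr_inf 1 N.
Proof.
move=> N0; pose A := Num.min 1 N.
have A0 : 0 < A by rewrite lt_min ltr01.
apply: (lt_le_trans A0); apply: le_gbarr_inf => // [|T T0]; first exact: ltW.
have := @le_gbarr R m 1 N T 1 ler01 (ltW N0) T0 m0 (fun s => A * sin (s - T)).
rewrite (@hl_deriven_sin R m) ?(ltW T0) // subrr add0r mul1r sin_pihalf mulr1; apply.
by apply: bounded_upto_sin; rewrite gtr0_norm // ge_min lexx ?orbT.
Qed.

Lemma root_exists X : 0 <= X -> exists2 x, 0 <= x & x ^+ m.+1 = X.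
Proof.
move=> X0; exists (X `^ (m.+1%:R)^-1); first exact: powR_ge0.
by rewrite -powR_mulrn ?powR_ge0 // -powRrM mulVf // powRr1.
Qed.

(** For [x > 0], scaling by [x] and by its inverse gives the two inequalities; for [x = 0], the
    upper bound comes from small positive values by monotonicity. *)
Lemma gbarr_inf_powE x N : 0 <= x -> 0 <= N ->
  gbarr_inf (x ^+ m.+1) N = x * gbarr_inf 1 N.
Proof.
move=> x0 N0; have le1 y : 0 < y -> gbarr_inf (y ^+ m.+1) N <= y * gbarr_inf 1 N.
  move=> y0; have yi : 0 < y^-1 by rewrite invr_gt0.
  have := gbarr_inf_scale (exprn_ge0 m.+1 (ltW y0)) N0 yi.
  by rewrite -exprMn mulVf ?gt_eqF // expr1n ler_pdivrMl.
apply/eqP; rewrite eq_le; apply/andP; split; last first.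
  move: x0; rewrite (le_eqVlt 0 x) => /orP[/eqP <-|x0]; last first.
    by have := gbarr_inf_scale ler01 N0 x0; rewrite mulr1.
  by rewrite mul0r expr0n; apply: le_gbarr_inf => // T T0; exact: gbarr_ge0.
move: x0; rewrite (le_eqVlt 0 x) => /orP[/eqP <-|]; last exact: le1.
rewrite mul0r; apply/ler_addgt0Pr => e e0; rewrite add0r.
pose q := gbarr_inf 1 N + 1.
have q1 : 0 <= gbarr_inf 1 N by apply: le_gbarr_inf => // T T0; exact: gbarr_ge0.
have q0 : 0 < q by rewrite ltr_wpDl.
have eq0 : 0 < e / q by rewrite divr_gt0.
have := gbarr_inf_mono (L' := (e / q) ^+ m.+1) (lexx 0) (exprn_ge0 _ (ltW eq0)) N0.
rewrite expr0n => /le_trans; apply; apply: (le_trans (le1 _ eq0)).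
by rewrite -mulrA ler_piMr ?(ltW e0) // mulrC ler_pdivrMr // mul1r lerDl.
Qed.

Lemma gbarr_inf_lt X Y N : 0 <= X -> X < Y -> 0 < N -> gbarr_inf X N < gbarr_inf Y N.
Proof.
move=> X0 XY N0.
have [x x0 xE] := root_exists X0; have [y y0 yE] := root_exists (ltW (le_lt_trans X0 XY)).
rewrite -xE -yE !gbarr_inf_powE ?(ltW N0) // ltr_pM2r ?gbarr_inf_gt0 //.
by rewrite -(@ltr_pXn2r _ m.+1) ?nnegrE ?xE ?yE.
Qed.

(** Strict concavity of the root of order [m.+1], obtained from strict convexity of the power;
    [0 < m] makes the exponent exceed 1. *)
Lemma gbarr_inf_midpoint_lt X Y N : 0 <= X -> 0 <= Y -> X != Y -> 0 < N ->
  (gbarr_inf X N + gbarr_inf Y N) / 2 < gbarr_inf ((X + Y) / 2) N.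
Proof.
move=> X0 Y0 XY N0.
have [x x0 xE] := root_exists X0; have [y y0 yE] := root_exists Y0.
have xy : x != y by apply: contra_neq XY => xy; rewrite -xE -yE xy.
have mid0 : 0 <= (x + y) / 2 by rewrite divr_ge0 // addr_ge0.
have := gbarr_inf_lt (exprn_ge0 m.+1 mid0) (expr_midpoint_lt (n := m.+1) _ x0 y0 xy) N0.
move=> /(_ m0); rewrite xE yE; apply: le_lt_trans.
by rewrite -xE -yE !gbarr_inf_powE ?(ltW N0) //; lra.
Qed.

End LongTimeBound.

(** * Optimal differentiators *)

Section Differentiator.
Variables (R : realType) (m : nat) (D : differentiator R m).
Hypotheses (m0 : (0 < m)%N) (causalD : causal D).
Implicit Types (f g u : R -> R) (L N t T alpha E : R) (i : 'I_m).

Lemma admissible_noisy L N f eta : 0 <= L -> 0 <= N ->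
  smooth_class_le m L f -> noise_class N eta -> admissible_input (f \+ eta).
Proof.
move=> L0 N0 fL etaN; exists m, L, N; split => //.
by exists f => //; exists eta.
Qed.

Lemma noise_class0 N : 0 <= N -> noise_class N (fun=> 0 : R).
Proof. by move=> N0 t _; rewrite normr0. Qed.

Lemma add_noise0 f : f \+ (fun=> 0) = f.
Proof. by apply/funext => t /=; rewrite addr0. Qed.

Lemma smooth_class_admissible L f : 0 <= L -> smooth_class_le m L f -> admissible_input f.
Proof.
move=> L0 fL; rewrite -(add_noise0 f).
exact: admissible_noisy L0 (lexx 0) fL (noise_class0 (lexx 0)).
Qed.

(** Only closeness of the input to [f] up to [T] is demanded, so a single input can be tested
    against two signals at once. *)
Definition error_le L N T i E := forall f u,
  smooth_class_le m L f -> admissible_input u ->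
  (forall s, 0 <= s <= T -> `|u s - f s| <= N) ->
  `|hl_deriven i.+1 f T - D u T ord0 i| <= E.

Lemma worst_case_error_ge S N i t f eta tau :
  S f -> noise_class N eta -> t <= tau ->
  (`|hl_deriven i.+1 f tau - D (f \+ eta) tau ord0 i|%:E <= worst_case_error D N S i t)%E.
Proof.
move=> Sf etaN tau_t; apply: le_trans (ereal_sup_ubound _); last first.
  by exists f => //; exists eta.
by apply: ereal_sup_ubound; exists tau; rewrite //= in_itv /= andbT.
Qed.

Lemma worst_case_error_le S N i t (E : \bar R) :
  (forall f eta tau, S f -> noise_class N eta -> t <= tau ->
    (`|hl_deriven i.+1 f tau - D (f \+ eta) tau ord0 i|%:E <= E)%E) ->
  (worst_case_error D N S i t <= E)%E.
Proof.
move=> H; apply: ge_ereal_sup => _ [f Sf [eta etaN <-]].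
apply: ge_ereal_sup => _ [tau + <-]; rewrite /= in_itv /= andbT => t_tau.
exact: H.
Qed.

Section BestWorstCase.
Variables (L N : R).
Hypotheses (L0 : 0 <= L) (N0 : 0 <= N) (bestD : best_worst_case D L N).

Lemma best_error_le T i : 0 < T -> error_le L N T i (gbarr m L N i.+1 T).
Proof.
move=> T0 f u fL uA ufN.
(* Cutting the deviation off after [T] makes it noise on the whole half-line; by causality the
   output at [T] is unchanged. *)
pose eta s := if 0 <= s <= T then u s - f s else 0.
have etaN : noise_class N eta.
  by move=> s s0; rewrite /eta; case: ifP => [/ufN //|_]; rewrite normr0.
have -> : D u T = D (f \+ eta) T.
  apply: causalD => //; [exact: admissible_noisy fL etaN|exact: ltW|].
  by move=> s sT; rewrite /= /eta sT addrC subrK.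
rewrite -lee_fin gbarrE //.
(* The initial bounds are those attained by [f] itself. *)
pose r (j : 'I_m.+1) := `|hl_deriven j f 0|.
apply: le_trans (bestD (r := r) _ T0 i); last by move=> j; exact: normr_ge0.
apply: worst_case_error_ge => //; split => //.
Qed.

(* Perturb f by +-(1 - alpha) g with g nearly extremal for gbar: the same input
   is then within the full noise level of both, which costs (1 - alpha) gbar. *)
Lemma best_error_le_scaled alpha T i : 0 <= alpha <= 1 -> 0 < T ->
  error_le (alpha * L) (alpha * N) T i (alpha * gbarr m L N i.+1 T).
Proof.
move=> /andP[a0 a1] T0 f u fL uA ufN.
have im : (i.+1 <= m)%N := ltn_ord i.
have base := best_error_le i T0.
pose b := 1 - alpha; have b0 : 0 <= b by rewrite subr_ge0.
set x := _ - _; set G := gbarr _ _ _ _ _.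
have key g c : bounded_upto m L N T g -> `|c| = b ->
    `|x + c * hl_deriven i.+1 g T| <= G.
  move=> [gL gN] cb.
  have := base (fun s => 1 * f s + c * g s) u.
  rewrite (hl_deriven_lin _ _ fL gL im (ltW T0)) mul1r addrAC; apply => //.
    by apply: (smooth_class_le_lin fL gL); rewrite normr1 mul1r cb /b; lra.
  move=> s sT; rewrite mul1r opprD addrA (le_trans (ler_normB _ _)) // normrM cb.
  by have := ufN s sT; have := ler_wpM2l b0 (gN s sT); rewrite /b; lra.
(* Taking both [c = b] and [c = - b] covers either sign of [x]. *)
have xG g : bounded_upto m L N T g -> b * hl_deriven i.+1 g T <= G - `|x|.
  move=> gG; have h1 := key g b gG (ger0_norm b0).
  have := key g (- b) gG; rewrite normrN => /(_ (ger0_norm b0)) h2.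
  move: h1 h2; rewrite !ler_norml => /andP[_ h1] /andP[h2 _].
  by case: (ger0P x) => _; lra.
(* Division by [b] fails for [alpha = 1], where the zero perturbation already gives the bound. *)
have [b0'|b1] := eqVneq b 0.
  have gG : bounded_upto m L N T (fun s => 0 * sin (s + 0)).
    by apply: bounded_upto_sin; rewrite normr0.
  have := xG _ gG; rewrite b0' mul0r subr_ge0.
  have -> : alpha = 1 by move: b0'; rewrite /b; lra.
  by rewrite mul1r.
have b_gt0 : 0 < b by rewrite lt_def b1.
have : G <= (G - `|x|) / b.
  by apply: gbarr_le => // g gG; rewrite ler_pdivlMr // mulrC xG.
by rewrite ler_pdivlMr // /b; lra.
Qed.

Lemma best_error_le_from alpha i t f eta tau : 0 <= alpha <= 1 -> 0 < t -> t <= tau ->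
  smooth_class_le m (alpha * L) f -> noise_class (alpha * N) eta ->
  `|hl_deriven i.+1 f tau - D (f \+ eta) tau ord0 i| <= alpha * gbarr m L N i.+1 t.
Proof.
move=> a01 t0 t_tau fL etaN; have /andP[a0 a1] := a01.
have tau0 := lt_le_trans t0 t_tau.
apply: (@le_trans _ _ (alpha * gbarr m L N i.+1 tau)).
  apply: (best_error_le_scaled i a01 tau0) => //.
    by apply: admissible_noisy fL etaN; rewrite mulr_ge0.
  by move=> s /andP[s0 _] /=; rewrite addrC addKr; exact: etaN.
by rewrite ler_wpM2l // gbarr_nonincreasing // ltn_ord.
Qed.

Lemma best_worst_case_scaled alpha : 0 <= alpha <= 1 ->
  best_worst_case D (alpha * L) (alpha * N).
Proof.
move=> a01 r r0 t t0 i; have /andP[a0 a1] := a01.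
apply: worst_case_error_le => f eta tau [fL _] etaN t_tau.
have im : (i.+1 <= m)%N := ltn_ord i.
rewrite -gbarrE ?mulr_ge0 // lee_fin.
apply: le_trans (gbarr_homogeneous L0 N0 t0 im a0).
exact: best_error_le_from.
Qed.

(** The scaled bound with [alpha = 0]. *)
Lemma best_error_polynomial i f eta tau : 0 < tau ->
  smooth_class_le m 0 f -> noise_class 0 eta ->
  hl_deriven i.+1 f tau = D (f \+ eta) tau ord0 i.
Proof.
move=> tau0 fL eta0; apply/eqP; rewrite -subr_eq0 -normr_le0.
rewrite -[leRHS](mul0r (gbarr m L N i.+1 tau)).
by apply: best_error_le_from; rewrite ?mul0r ?lexx ?ler01.
Qed.

Lemma best_exact_from_beginning : exact_from_beginning D 0.
Proof.
move=> t t0 i; apply/eqP; rewrite eq_le; apply/andP; split.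
  apply: worst_case_error_le => f eta tau fL eta0 t_tau.
  by rewrite (best_error_polynomial _ (lt_le_trans t0 t_tau) fL eta0) subrr normr0.
(* A member of the class is exhibited, since the supremum of an empty set would be -oo. *)
pose f (s : R) : R := 0 * sin (s + 0).
have fL : smooth_class_le m 0 f by apply: smooth_class_le_sin; rewrite normr0.
by apply: le_trans (worst_case_error_ge i fL (noise_class0 (lexx 0)) (lexx t)); rewrite lee_fin.
Qed.

(** Without noise the output is the exact derivative, so the deviation is an estimation error; with
    [alpha = eps / N] it is at most [eps / N * G], which tends to 0. *)
Lemma best_robust : 0 < N -> robust_almost_from_beginning D (smooth_class_le m 0).
Proof.
move=> N_gt0 t t0 i; pose G := gbarr m L N i.+1 t.
apply: (@squeeze_cvge _ _ _ _ (cst 0%E) _ (fun eps => (eps / N * G)%:E)).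
- near=> eps; apply/andP; split.
    pose f (s : R) : R := 0 * sin (s + 0).
    have fL : smooth_class_le m 0 f by apply: smooth_class_le_sin; rewrite normr0.
    have eps0 : 0 <= eps by apply/ltW; near: eps; exact: nbhs_right_gt.
    apply: le_trans (ereal_sup_ubound _); last first.
      by exists f => //; exists (fun=> 0) => //; exact: noise_class0.
    apply: le_trans (ereal_sup_ubound _); last by exists t; rewrite //= in_itv /= lexx.
    by rewrite lee_fin.
  apply: ge_ereal_sup => _ [u uL [eta etaN <-]].
  apply: ge_ereal_sup => _ [tau + <-]; rewrite /= in_itv /= andbT => t_tau.
  rewrite lee_fin -[X in `|D X _ _ _ - _|]add_noise0.
  rewrite -(best_error_polynomial _ (lt_le_trans t0 t_tau) uL (noise_class0 (lexx 0))).
  have eps0 : 0 <= eps by apply/ltW; near: eps; exact: nbhs_right_gt.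
  have epsN : eps <= N by near: eps; exact: nbhs_right_le.
  apply: best_error_le_from => //.
  + by rewrite divr_ge0 // ler_pdivrMr // mul1r.
  + by apply: smooth_class_leW uL; rewrite mulr_ge0 // divr_ge0.
  + by rewrite divfK // gt_eqF.
- exact: cvg_cst.
- apply: cvg_EFin; first by near=> eps.
  have : (fun eps : R => eps / N * G) x @[x --> 0^'+] --> (0 / N * G : R).
    apply: cvgM; last exact: cvg_cst.
    apply: cvgM; last exact: cvg_cst.
    apply: cvg_trans (@cvg_id _ _); apply: cvg_within.
  by rewrite !mul0r.
Unshelve. all: by end_near.
Qed.

End BestWorstCase.

(* For h in the sum class, the signals - x h and (1 - x) h differ by h; with x
   and w the shares of L1 and N1 in the sums, the input (w - x) h is within N1
   of the first and within N2 of the second. *)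
Lemma error_le_superadditive L1 N1 L2 N2 T i E1 E2 :
  0 <= L1 -> 0 <= N1 -> 0 <= L2 -> 0 <= N2 -> 0 < T ->
  error_le L1 N1 T i E1 -> error_le L2 N2 T i E2 ->
  gbarr m (L1 + L2) (N1 + N2) i.+1 T <= E1 + E2.
Proof.
move=> L10 N10 L20 N20 T0 H1 H2; have im : (i.+1 <= m)%N := ltn_ord i.
(* If the sum vanishes then so do both terms, and the share 0 will do. *)
have share (a b : R) : 0 <= a -> 0 <= b ->
    exists x, [/\ 0 <= x <= 1, x * (a + b) = a & (1 - x) * (a + b) = b].
  move=> a0 b0; have [s0|s0] := eqVneq (a + b) 0.
    by exists 0; split; rewrite ?lexx ?ler01 //; lra.
  have s1 : 0 < a + b by rewrite lt_def s0 addr_ge0.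
  have e1 : a / (a + b) * (a + b) = a by rewrite divfK.
  exists (a / (a + b)); split => //; last by rewrite mulrBl e1; lra.
  by rewrite divr_ge0 ?addr_ge0 //= ler_pdivrMr // mul1r lerDl.
have [x [/andP[x0 x1] xE1 xE2]] := share _ _ L10 L20.
have [w [/andP[w0 w1] wE1 wE2]] := share _ _ N10 N20.
have S0 : 0 <= L1 + L2 by rewrite addr_ge0.
apply: gbarr_le => //; first by rewrite addr_ge0.
move=> h [hL hN].
pose lin c := fun s : R => c * h s + 0 * h s.
have linL c K : `|c| * (L1 + L2) <= K -> smooth_class_le m K (lin c).
  by move=> cK; apply: (smooth_class_le_lin hL hL); rewrite normr0 mul0r addr0.
have linD c : hl_deriven i.+1 (lin c) T = c * hl_deriven i.+1 h T.
  by rewrite (hl_deriven_lin _ _ hL hL im (ltW T0)) mul0r addr0.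
have uA : admissible_input (lin (w - x)).
  by apply: (smooth_class_admissible _ (linL (w - x) _ (lexx _))); rewrite mulr_ge0.
have := H1 (lin (- x)) _ _ uA _; have := H2 (lin (1 - x)) _ _ uA _.
rewrite !linD => e2 e1.
have {}e1 := e1 (linL _ _ _) _; have {}e2 := e2 (linL _ _ _) _.
have e1' : `|- x * hl_deriven i.+1 h T - D (lin (w - x)) T ord0 i| <= E1.
  apply: e1; first by rewrite normrN ger0_norm // xE1.
  move=> s sT; have -> : lin (w - x) s - lin (- x) s = w * h s by rewrite /lin; ring.
  by rewrite normrM ger0_norm // -wE1 ler_wpM2l // hN.
have e2' : `|(1 - x) * hl_deriven i.+1 h T - D (lin (w - x)) T ord0 i| <= E2.
  apply: e2; first by rewrite ger0_norm ?subr_ge0 // xE2.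
  move=> s sT; have -> : lin (w - x) s - lin (1 - x) s = - ((1 - w) * h s) by rewrite /lin; ring.
  by rewrite normrN normrM ger0_norm ?subr_ge0 // -wE2 ler_wpM2l ?subr_ge0 // hN.
by move: e1' e2'; rewrite !ler_norml => /andP[h1 _] /andP[_ h2]; lra.
Qed.

(** For [h] in the class with bound [2 * L], exactness gives the true slope for the input [h / 2].
    This input is also within [N] of [- h / 2], so the slope of [h] at [T] is an error bounded by
    [gbarr m L N 1 T]. *)
Lemma best_not_exact L N : 0 <= L -> 0 <= N -> best_worst_case D L N ->
  0 < N -> 0 < L -> not_exact D L.
Proof.
move=> L0 N0 bestD N_gt0 L_gt0 exactD.
have L20 : 0 <= 2 * L by rewrite mulr_ge0.
pose i0 : 'I_m := Ordinal m0.
(* The time of exactness depends on the initial bounds, which must thus be uniform in [h] and [T]: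
   they are taken from the interval [0, 1], whence [1 <= T] below. *)
have : forall j : 'I_m.+1, exists B : R, 0 <= B /\ forall g, bounded_upto m (2 * L) N 1 g ->
    forall t, 0 <= t <= 1 -> `|hl_deriven j g t| <= B.
  move=> j; have [B B0 H] := bounded_upto_deriven_le L20 N0 ltr01 (ltn_ord j : (j <= m)%N).
  by exists B.
move=> /choice[r rP].
have [T0 T00 exactT] := exactD r (fun j => proj1 (rP j)).
have key T : T0 <= T -> 1 <= T -> gbarr m (2 * L) N 1 T <= gbarr m L N 1 T.
  move=> T0T T1; have T_gt0 := lt_le_trans T00 T0T.
  apply: gbarr_le => // h [hL hN].
  pose lin c := fun s : R => c * h s + 0 * h s.
  have linL c : `|c| = 1 / 2 -> smooth_class_le m L (lin c).
    by move=> cK; apply: (smooth_class_le_lin hL hL); rewrite normr0 mul0r addr0 cK; lra.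
  have linD c k t : (k <= m)%N -> 0 <= t -> hl_deriven k (lin c) t = c * hl_deriven k h t.
    by move=> km t0; rewrite (hl_deriven_lin _ _ hL hL km t0) mul0r addr0.
  have hf : `|1 / 2 : R| = 1 / 2 by rewrite ger0_norm.
  have exact_h : hl_deriven 1 (lin (1 / 2)) T = D (lin (1 / 2)) T ord0 i0.
    apply/eqP; rewrite -subr_eq0 -normr_le0 -lee_fin -[leRHS](exactT i0) -[X in D X]add_noise0.
    apply: worst_case_error_ge => //; last exact: noise_class0.
    split; first exact: linL.
    move=> j; rewrite linD 1?normrM ?hf; [|exact: (ltn_ord j)|exact: lexx].
    have [rj0 /(_ h)] := rP j; have hG : bounded_upto m (2 * L) N 1 h.
      by split=> // t /andP[t0 t1]; apply: hN; rewrite t0 (le_trans t1).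
    by move=> /(_ hG 0); rewrite lexx ler01 => /(_ isT); lra.
  have := @best_error_le L N L0 N0 bestD T i0 T_gt0 (lin (- (1 / 2))) (lin (1 / 2)).
  rewrite -exact_h !linD ?(ltW T_gt0) // => H.
  have {}H := H (linL _ _) (smooth_class_admissible L0 (linL _ hf)) _.
  have : `|- (1 / 2) * hl_deriven 1 h T - 1 / 2 * hl_deriven 1 h T| <= gbarr m L N 1 T.
    apply: H; first by rewrite normrN.
    move=> s sT; have -> : lin (1 / 2) s - lin (- (1 / 2)) s = h s by rewrite /lin; field.
    exact: hN.
  by rewrite ler_norml => /andP[+ _]; lra.
have := @gbarr_inf_lt R m m0 L (2 * L) N L0 _ N_gt0.
move=> /(_ ltac:(lra)); apply/negP; rewrite -leNgt.
apply: le_gbarr_inf => // T T_gt0.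
pose T' := Num.max T (Num.max T0 1).
have TT' : T <= T' by rewrite le_max lexx.
apply: (@le_trans _ _ (gbarr m L N 1 T')); last exact: gbarr_nonincreasing.
apply: le_trans (key T' _ _); rewrite ?le_max ?lexx ?orbT //.
by apply: gbarr_inf_le => //; exact: lt_le_trans TT'.
Qed.

(** For [N = 0], superadditivity gives Phi(L + L', N') <= Phi(L', N'), hence [L = 0]. Otherwise the
    second pair is scaled down by [b = N / N'] to noise level [N], and strict concavity forces
    [L = b * L']. *)
Lemma best_proportional_le L N L' N' : 0 <= L -> 0 <= N -> 0 <= L' -> 0 < N' -> N <= N' ->
  best_worst_case D L N -> best_worst_case D L' N' -> L * N' = L' * N.
Proof.
move=> L0 N0 L'0 N'0 NN' bestD bestD'.
pose i0 : 'I_m := Ordinal m0.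
have N'0w := ltW N'0.
move: N0; rewrite (le_eqVlt 0 N) => /orP[/eqP N0|N0].
  rewrite -N0 mulr0; apply/eqP; rewrite mulf_eq0 (gt_eqF N'0) orbF eq_le L0 andbT leNgt.
  apply/negP => L_gt0.
  have := @gbarr_inf_lt R m m0 L' (L + L') N' L'0 _ N'0.
  move=> /(_ ltac:(lra)); apply/negP; rewrite -leNgt.
  apply: le_gbarr_inf => // T T0.
  apply: (le_trans (gbarr_inf_le m0 _ N'0w T0)); first by rewrite addr_ge0.
  have e1 := best_error_le L0 (lexx 0) (eq_ind_r (best_worst_case D L) bestD N0) i0 T0.
  have e2 := best_error_le L'0 N'0w bestD' i0 T0.
  have := error_le_superadditive L0 (lexx 0) L'0 N'0w T0 e1 e2.
  by rewrite add0r; have := gbarr_noiseless m0 L0 T0; lra.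
pose b := N / N'; have b0 : 0 <= b by rewrite divr_ge0 // ltW.
have b1 : b <= 1 by rewrite ler_pdivrMr // mul1r.
have bN : b * N' = N by rewrite divfK // gt_eqF.
have N0w := ltW N0; have bL0 : 0 <= b * L' by rewrite mulr_ge0.
suff -> : L = b * L' by rewrite -bN; ring.
apply/eqP/negPn/negP => Lne.
have := gbarr_inf_midpoint_lt m0 L0 bL0 Lne N0.
apply/negP; rewrite -leNgt.
have S0 : 0 <= L + b * L' by rewrite addr_ge0.
have h1 : gbarr_inf m (L + b * L') (N + N) <= gbarr_inf m L N + gbarr_inf m (b * L') N.
  apply: gbarr_inf_subadd => // [|T T0]; first by rewrite addr_ge0.
  have e1 := best_error_le L0 N0w bestD i0 T0.
  have := best_worst_case_scaled L'0 N'0w bestD' (alpha := b).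
  rewrite b0 b1 bN => /(_ isT) bestD''.
  have e2 := best_error_le bL0 N0w bestD'' i0 T0.
  exact: error_le_superadditive e1 e2.
have := @gbarr_inf_homogeneous R m m0 2 ((L + b * L') / 2) N _ N0w _.
rewrite divr_ge0 // => /(_ isT (ler0n _ 2)).
have -> : 2 * ((L + b * L') / 2) = L + b * L' by field.
have -> : 2 * N = N + N by ring.
by lra.
Qed.

End Differentiator.

Theorem proposition5p2 (R : realType) (L N L' N' : R) (m : nat)
    (D : differentiator R m) :
  0 <= L -> 0 <= N -> 0 <= L' -> 0 <= N' -> (0 < m)%N ->
  causal D ->
  best_worst_case D L N ->
  [/\ (forall alpha : R, 0 <= alpha <= 1 ->
         best_worst_case D (alpha * L) (alpha * N)),
      exact_from_beginning D 0,
      (0 < N -> robust_almost_from_beginning D (smooth_class_le m 0)),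
      (0 < N -> 0 < L -> not_exact D L) &
      (best_worst_case D L' N' -> L * N' = L' * N)].
Proof.
move=> L0 N0 L'0 N'0 m0 causalD bestD; split.
- by move=> alpha; exact: best_worst_case_scaled.
- exact: best_exact_from_beginning L0 N0 bestD.
- by apply: best_robust bestD.
- by apply: best_not_exact bestD.
(* The two pairs play symmetric roles, so the smaller noise bound may come first; if the larger one
   is 0, both are. *)
move=> bestD'; have [NN'|N'N] := leP N N'.
  move: N'0; rewrite (le_eqVlt 0 N') => /orP[/eqP N'0|N'0].
    by have -> : N = 0; [apply/eqP; rewrite eq_le N0 N'0 NN'|rewrite -N'0 !mulr0].
  by apply: best_proportional_le bestD bestD'.
apply/esym; apply: best_proportional_le bestD' bestD => //; last exact: ltW.
exact: le_lt_trans N'N.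
Qed.
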